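(* Let $\mathcal A$ be a finitely complete category. The following are equivalent. (1) $\mathcal A$ is propointed. (2) There exists a conservative right-adjoint functor $U\colon\mathcal A\to\mathcal X$ with $\mathcal X$ pointed and finitely complete. (3) $\mathcal A$ admits an initial object and there exists a conservative left-exact functor $U\colon\mathcal A\to\mathcal X$ with $\mathcal X$ pointed and finitely complete.
   Context: A finitely complete category $\mathcal A$ is called propointed if it admits an initial object $0$ and the unique morphism $0\to 1$ to the terminal object is a universal extremal epimorphism, i.e. an extremal epimorphism all of whose pullbacks are extremal epimorphisms. (An extremal epimorphism is a morphism $f$ such that whenever $f=m\circ g$ with $m$ a monomorphism, $m$ is an isomorphism.) A category is pointed if it has a zero object. A functor is right-adjoint if it admits a left adjoint, conservative if it reflects isomorphisms, left-exact if it preserves finite limits. *)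

(* Defs.v *)
From Stdlib Require Import List FinFun.

Set Implicit Arguments.
Unset Strict Implicit.
Unset Printing Implicit Defensive.

Declare Scope cat_scope.
Local Open Scope cat_scope.

Record Category := {
  Ob :> Type;
  Hom : Ob -> Ob -> Type;
  idm : forall x, Hom x x;
  comp : forall x y z, Hom y z -> Hom x y -> Hom x z;
  comp_idl : forall x y (f : Hom x y), comp (idm y) f = f;
  comp_idr : forall x y (f : Hom x y), comp f (idm x) = f;
  comp_assoc : forall w x y z (h : Hom y z) (g : Hom x y) (f : Hom w x),
    comp h (comp g f) = comp (comp h g) f
}.

Arguments Hom {c} _ _.
Arguments idm {c} _.
Arguments comp {c x y z} _ _.
Arguments comp_idl {c x y} _.
Arguments comp_idr {c x y} _.
Arguments comp_assoc {c w x y z} _ _ _.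

Notation "g ∘ f" := (comp g f) (at level 40, left associativity) : cat_scope.

Record Functor (A B : Category) := {
  fob :> Ob A -> Ob B;
  fmap : forall x y : A, Hom x y -> Hom (fob x) (fob y);
  fmap_id : forall x : A, fmap (idm x) = idm (fob x);
  fmap_comp : forall (x y z : A) (g : Hom y z) (f : Hom x y),
    fmap (g ∘ f) = fmap g ∘ fmap f
}.

Arguments fmap {A B} _ {x y} _.
Arguments fmap_id {A B} _ _.
Arguments fmap_comp {A B} _ {x y z} _ _.

Definition fcomp (A B C : Category) (G : Functor B C) (F : Functor A B) :
  Functor A C.
Proof.
refine {| fob := fun x => G (F x);
          fmap := fun x y f => fmap G (fmap F f) |}.
- intros x. now rewrite !fmap_id.
- intros x y z g f. now rewrite !fmap_comp.
Defined.

Section Morphisms.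

Variable A : Category.

Definition is_iso (x y : A) (f : Hom x y) : Prop :=
  exists g : Hom y x, g ∘ f = idm x /\ f ∘ g = idm y.

Definition is_mono (x y : A) (m : Hom x y) : Prop :=
  forall (w : A) (g h : Hom w x), m ∘ g = m ∘ h -> g = h.

Definition is_initial (z : A) : Prop :=
  forall x : A, exists! f : Hom z x, True.

Definition is_terminal (t : A) : Prop :=
  forall x : A, exists! f : Hom x t, True.

Definition is_zero (z : A) : Prop := is_initial z /\ is_terminal z.

(* Being epic is not required: it follows when equalizers exist. *)
Definition is_extremal_epi (x y : A) (f : Hom x y) : Prop :=
  forall (w : A) (g : Hom x w) (m : Hom w y),
    is_mono m -> f = m ∘ g -> is_iso m.

(* The square
     p --p2--> z
     |         |
     p1        g
     v         v
     x --f---> y   *)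
Definition is_pullback (x y z p : A)
    (f : Hom x y) (g : Hom z y) (p1 : Hom p x) (p2 : Hom p z) : Prop :=
  f ∘ p1 = g ∘ p2 /\
  forall (q : A) (q1 : Hom q x) (q2 : Hom q z), f ∘ q1 = g ∘ q2 ->
    exists! u : Hom q p, p1 ∘ u = q1 /\ p2 ∘ u = q2.

Definition is_universal_extremal_epi (x y : A) (f : Hom x y) : Prop :=
  is_extremal_epi f /\
  forall (z p : A) (g : Hom z y) (p1 : Hom p x) (p2 : Hom p z),
    is_pullback f g p1 p2 -> is_extremal_epi p2.

End Morphisms.

Record Cone (J A : Category) (D : Functor J A) := {
  apex : A;
  leg : forall j : J, Hom apex (D j);
  leg_natural : forall (i j : J) (a : Hom i j), fmap D a ∘ leg i = leg j
}.

Arguments apex {J A D} _.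
Arguments leg {J A D} _ _.
Arguments leg_natural {J A D} _ {i j} _.

Definition is_limit (J A : Category) (D : Functor J A) (c : Cone D) : Prop :=
  forall c' : Cone D,
    exists! u : Hom (apex c') (apex c), forall j : J, leg c j ∘ u = leg c' j.

Definition map_cone (J A B : Category) (D : Functor J A) (F : Functor A B)
    (c : Cone D) : Cone (fcomp F D).
Proof.
refine {| apex := F (apex c);
          leg := fun j => fmap F (leg c j) : Hom (F (apex c)) (fcomp F D j) |}.
intros i j a. simpl. now rewrite <- fmap_comp, leg_natural.
Defined.

Definition finite_category (J : Category) : Prop :=
  Finite J /\ forall i j : J, Finite (Hom i j).

Definition finitely_complete (A : Category) : Prop :=
  forall J : Category, finite_category J ->
  forall D : Functor J A, exists c : Cone D, is_limit c.

Definition left_exact (A B : Category) (F : Functor A B) : Prop :=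
  forall J : Category, finite_category J ->
  forall (D : Functor J A) (c : Cone D), is_limit c -> is_limit (map_cone F c).

Definition conservative (A B : Category) (F : Functor A B) : Prop :=
  forall (x y : A) (f : Hom x y), is_iso (fmap F f) -> is_iso f.

(* F is left adjoint to U. *)
Record Adjunction (X A : Category) (F : Functor X A) (U : Functor A X) := {
  transpose : forall (x : X) (a : A), Hom (F x) a -> Hom x (U a);
  untranspose : forall (x : X) (a : A), Hom x (U a) -> Hom (F x) a;
  transposeK : forall (x : X) (a : A) (f : Hom (F x) a),
    untranspose (transpose f) = f;
  untransposeK : forall (x : X) (a : A) (g : Hom x (U a)),
    transpose (untranspose g) = g;
  transpose_natural : forall (x x' : X) (a a' : A)
      (h : Hom x' x) (k : Hom a a') (f : Hom (F x) a),
    transpose (k ∘ f ∘ fmap F h) = fmap U k ∘ transpose f ∘ h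
}.

Definition right_adjoint (A X : Category) (U : Functor A X) : Prop :=
  exists F : Functor X A, inhabited (Adjunction F U).

Definition has_initial (A : Category) : Prop := exists z : A, is_initial z.

Definition pointed (A : Category) : Prop := exists z : A, is_zero z.

Definition propointed (A : Category) : Prop :=
  finitely_complete A /\
  exists (z t : A) (f : Hom z t),
    is_initial z /\ is_terminal t /\ is_universal_extremal_epi f.

(* Main.v *)
From Stdlib Require Import List FinFun ProofIrrelevance IndefiniteDescription.
Require Import Defs.

(** The witness for (2) is the base change functor [x ↦ (x × 0 → 0)] from [A] to
    the slice [A/0], which is pointed because its terminal object [id : 0 → 0] is
    also initial; the functor is right adjoint to the domain functor.  If [0 → 1]
    is a universal extremal epimorphism then every projection [y × 0 → y] is an
    extremal epimorphism, so a monomorphism sent to an isomorphism is one; a left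
    exact functor with that property is conservative, as one sees on diagonals of
    kernel pairs.
    For (3) ⇒ (1), [U 1] is a zero object, so [U (0 → 1)] is a split epimorphism,
    and so are the images of all its pullbacks [p → z].  A monomorphism through
    which [p → z] factors is therefore sent by [U] to a monomorphism that is split
    epi, i.e. to an isomorphism. *)

Set Implicit Arguments.
Unset Strict Implicit.
Unset Printing Implicit Defensive.

Local Open Scope cat_scope.

(** * Elementary facts on terminal and initial objects, monomorphisms and isomorphisms *)

Lemma is_terminal_hom_eq (A : Category) (t x : A) (f g : Hom x t) :
  is_terminal t -> f = g.
Proof.
intros ht. destruct (ht x) as [h [_ hu]].
now rewrite <- (hu f I), <- (hu g I).
Qed.

Lemma is_initial_hom_eq (A : Category) (z x : A) (f g : Hom z x) :
  is_initial z -> f = g.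
Proof.
intros hz. destruct (hz x) as [h [_ hu]].
now rewrite <- (hu f I), <- (hu g I).
Qed.

Lemma mono_split_epi_is_iso (A : Category) (x y : A) (m : Hom x y) (s : Hom y x) :
  is_mono m -> m ∘ s = idm y -> is_iso m.
Proof.
intros hm hs. exists s. split; [|exact hs].
apply hm. now rewrite comp_assoc, hs, comp_idl, comp_idr.
Qed.

Lemma split_mono_is_mono (A : Category) (x y : A) (m : Hom x y) (r : Hom y x) :
  r ∘ m = idm x -> is_mono m.
Proof.
intros hr w g h e.
rewrite <- (comp_idl g), <- (comp_idl h), <- hr, <- !comp_assoc. now f_equal.
Qed.

Lemma is_iso_is_mono (A : Category) (x y : A) (m : Hom x y) :
  is_iso m -> is_mono m.
Proof. intros [r [hr _]]. exact (split_mono_is_mono hr). Qed.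

(** Recasts being monic as a limit condition, which left exact functors preserve. *)
Lemma is_mono_is_pullback (A : Category) (x y : A) (m : Hom x y) :
  is_mono m <-> is_pullback m m (idm x) (idm x).
Proof.
split.
- intros hm. split; [reflexivity|]. intros q q1 q2 e. exists q1. split.
  + rewrite !comp_idl. split; [reflexivity|]. now apply hm.
  + intros u [hu _]. now rewrite comp_idl in hu.
- intros [_ h] w g k e. destruct (h w g k e) as [u [[h1 h2] _]].
  now rewrite <- h1, <- h2.
Qed.

(** * Terminal objects and pullbacks as limits of finite diagrams *)

Definition empty_category : Category.
Proof.
refine {| Ob := Empty_set; Hom := fun _ _ => unit;
          idm := fun _ => tt; comp := fun _ _ _ _ _ => tt |};
intros [].
Defined.

Lemma empty_category_finite : finite_category empty_category.
Proof. split; [exists nil; intros []|intros []]. Qed.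

Definition empty_diagram (A : Category) : Functor empty_category A.
Proof.
refine {| fob := fun x : empty_category => match x with end;
          fmap := fun x => match x with end |}; intros [].
Defined.

Definition empty_cone (A : Category) (D : Functor empty_category A) (t : A) :
  Cone D.
Proof.
refine {| apex := t; leg := fun j : empty_category => match j with end |};
intros [].
Defined.

(** [D] is arbitrary rather than [empty_diagram], so that image cones [map_cone U c], which lie over
    a composite functor, are covered. *)
Lemma is_limit_empty (A : Category) (D : Functor empty_category A) (c : Cone D) :
  is_limit c <-> is_terminal (apex c).
Proof.
split; intros h.
- intros x. destruct (h (empty_cone D x)) as [u [_ hu]].
  exists u. split; [exact I|]. intros v _. apply hu. intros [].
- intros c'. destruct (h (apex c')) as [u [_ hu]].
  exists u. split; [intros []|]. intros v _. now apply hu.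
Qed.

Lemma finitely_complete_terminal (A : Category) :
  finitely_complete A -> exists t : A, is_terminal t.
Proof.
intros hA. destruct (hA _ empty_category_finite (empty_diagram A)) as [c hc].
exists (apex c). now apply is_limit_empty.
Qed.

Lemma left_exact_terminal (A B : Category) (U : Functor A B) (t : A) :
  left_exact U -> is_terminal t -> is_terminal (U t).
Proof.
intros hU ht.
apply (is_limit_empty (map_cone U (empty_cone (empty_diagram A) t))).
apply (hU _ empty_category_finite). now apply is_limit_empty.
Qed.

Inductive cospan_ob := cs_left | cs_right | cs_base.

Definition cospan_hom (i j : cospan_ob) : Type :=
  match i, j with
  | cs_left, cs_left | cs_right, cs_right | _, cs_base => unit
  | _, _ => Empty_set
  end.

Definition cospan : Category.
Proof.
refine {| Ob := cospan_ob; Hom := cospan_hom;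
          idm := fun i => match i with cs_left | cs_right | cs_base => tt end;
          comp := fun i j k =>
            match i, j, k with
            | cs_left, cs_left, cs_left => fun _ _ => tt
            | cs_right, cs_right, cs_right => fun _ _ => tt
            | cs_left, _, cs_base => fun _ _ => tt
            | cs_right, _, cs_base => fun _ _ => tt
            | cs_base, _, cs_base => fun _ _ => tt
            | cs_left, cs_left, cs_right => fun g _ => g
            | cs_left, cs_right, _ => fun _ f => match f with end
            | cs_left, cs_base, _ => fun g _ => match g with end
            | cs_right, cs_right, cs_left => fun g _ => g
            | cs_right, cs_left, _ => fun _ f => match f with end
            | cs_right, cs_base, _ => fun g _ => match g with end
            | cs_base, cs_left, _ => fun _ f => match f with end
            | cs_base, cs_right, _ => fun _ f => match f with end
            | cs_base, cs_base, _ => fun g _ => g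
            end |}.
- intros [] [] []; reflexivity.
- intros [] [] []; reflexivity.
- intros [] [] [] [] [] [] []; reflexivity.
Defined.

Lemma cospan_finite : finite_category cospan.
Proof.
split.
- exists (cs_left :: cs_right :: cs_base :: nil). intros []; simpl; tauto.
- intros [] []; simpl;
    first [exists (tt :: nil); intros []; simpl; tauto | exists nil; intros []].
Qed.

Section Cospan.

Variable A : Category.

Definition cospan_diagram (x y z : A) (f : Hom x y) (g : Hom z y) :
  Functor cospan A.
Proof.
refine {| fob := fun i : cospan =>
            match i with cs_left => x | cs_right => z | cs_base => y end;
          fmap := fun i j : cospan =>
            match i, j return @Hom cospan i j ->
              Hom (match i with cs_left => x | cs_right => z | cs_base => y end)
                  (match j with cs_left => x | cs_right => z | cs_base => y end)
            with
            | cs_left, cs_left => fun _ => idm x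
            | cs_right, cs_right => fun _ => idm z
            | cs_base, cs_base => fun _ => idm y
            | cs_left, cs_base => fun _ => f
            | cs_right, cs_base => fun _ => g
            | cs_left, cs_right => fun e => match e with end
            | cs_right, cs_left => fun e => match e with end
            | cs_base, cs_left => fun e => match e with end
            | cs_base, cs_right => fun e => match e with end
            end |}.
- intros []; reflexivity.
- intros [] [] [] [] []; simpl; now rewrite ?comp_idl, ?comp_idr.
Defined.

(** Naturality forces the leg at the base, so a cone amounts to a commuting square. Again [D] is
    arbitrary in order to cover image cones. *)
Lemma is_limit_cospan (D : Functor cospan A) (c : Cone D) :
  is_limit c <->
  is_pullback (fmap D (tt : @Hom cospan cs_left cs_base))
    (fmap D (tt : @Hom cospan cs_right cs_base))
    (leg c cs_left) (leg c cs_right).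
Proof.
split.
- intros h. split; [now rewrite !leg_natural|]. intros q q1 q2 e.
  unshelve epose (k := _ : Cone D).
  { refine {| apex := q; leg := fun j : cospan =>
      match j return Hom q (D j) with
      | cs_left => q1
      | cs_right => q2
      | cs_base => fmap D (tt : @Hom cospan cs_left cs_base) ∘ q1
      end |}.
    (* The only endomorphisms in [cospan] are identities, which settles naturality at every loop. *)
    assert (hid : forall (j : cospan) (a : Hom j j) (r : Hom q (D j)),
        fmap D a ∘ r = r).
    { intros j a r. replace a with (idm j) by (destruct j, a; reflexivity).
      now rewrite fmap_id, comp_idl. }
    intros [] [] []; try apply hid; [reflexivity|now symmetry]. }
  destruct (h k) as [u [hu huu]].
  exists u. split; [split; [exact (hu cs_left)|exact (hu cs_right)]|].
  intros v [h1 h2]. apply huu. intros []; [exact h1|exact h2|simpl].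
  now rewrite <- (leg_natural c (tt : @Hom cospan cs_left cs_base)),
    <- comp_assoc, h1.
- intros [_ h] c'.
  destruct (h (apex c') (leg c' cs_left) (leg c' cs_right))
    as [u [[h1 h2] hu]]; [now rewrite !leg_natural|].
  exists u. split.
  + intros []; [exact h1|exact h2|].
    now rewrite <- (leg_natural c (tt : @Hom cospan cs_left cs_base)),
      <- comp_assoc, h1, leg_natural.
  + intros v hv. apply hu. split; apply hv.
Qed.

Lemma finitely_complete_pullback :
  finitely_complete A ->
  forall (x y z : A) (f : Hom x y) (g : Hom z y),
  exists (p : A) (p1 : Hom p x) (p2 : Hom p z), is_pullback f g p1 p2.
Proof.
intros hA x y z f g.
destruct (hA _ cospan_finite (cospan_diagram f g)) as [c hc].
exists (apex c), (leg c cs_left), (leg c cs_right).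
exact (proj1 (is_limit_cospan c) hc).
Qed.

End Cospan.

Lemma left_exact_pullback (A B : Category) (U : Functor A B) :
  left_exact U ->
  forall (x y z p : A) (f : Hom x y) (g : Hom z y) (p1 : Hom p x) (p2 : Hom p z),
  is_pullback f g p1 p2 ->
  is_pullback (fmap U f) (fmap U g) (fmap U p1) (fmap U p2).
Proof.
intros hU x y z p f g p1 p2 h.
unshelve epose (c := _ : Cone (cospan_diagram f g)).
{ refine {| apex := p; leg := fun j : cospan =>
    match j return Hom p (cospan_diagram f g j) with
    | cs_left => p1 | cs_right => p2 | cs_base => f ∘ p1
    end |}.
  intros [] [] []; simpl; rewrite ?comp_idl; try reflexivity.
  symmetry. exact (proj1 h). }
exact (proj1 (is_limit_cospan (map_cone U c))
  (hU _ cospan_finite _ c (proj2 (is_limit_cospan c) h))).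
Qed.

(** * Left exact functors: monomorphisms and conservativity *)

Lemma left_exact_mono (A B : Category) (U : Functor A B) :
  left_exact U ->
  forall (x y : A) (m : Hom x y), is_mono m -> is_mono (fmap U m).
Proof.
intros hU x y m hm. apply is_mono_is_pullback. rewrite <- !fmap_id.
apply (left_exact_pullback hU). now apply is_mono_is_pullback.
Qed.

(** If [U g] is invertible, then [U] inverts the diagonal [d] of the kernel pair of [g]. As [d] is a
    split monomorphism, the hypothesis makes it invertible, so [g] is monic and the hypothesis
    applies to [g] itself. *)
Lemma left_exact_conservative (A B : Category) (U : Functor A B) :
  finitely_complete A -> left_exact U ->
  (forall (x y : A) (m : Hom x y), is_mono m -> is_iso (fmap U m) -> is_iso m) ->
  conservative U.
Proof.
intros hA hU hmono x y g hg. apply hmono; [|exact hg].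
destruct (finitely_complete_pullback hA g g) as (k & k1 & k2 & hk).
destruct (proj2 hk x (idm x) (idm x) eq_refl) as [d [[d1 d2] _]].
assert (hUd : is_iso (fmap U d)).
{ assert (e : fmap U k1 ∘ fmap U d = idm (U x))
    by now rewrite <- fmap_comp, d1, fmap_id.
  exists (fmap U k1). split; [exact e|].
  (* [U k1], being a pullback of the monomorphism [U g], is a monomorphism. *)
  assert (hm : is_mono (fmap U k1)).
  { intros w u v euv. destruct (left_exact_pullback hU hk) as [hc hu].
    assert (e2 : fmap U k2 ∘ u = fmap U k2 ∘ v).
    { apply (is_iso_is_mono hg).
      now rewrite !comp_assoc, <- hc, <- !comp_assoc, euv. }
    destruct (hu w (fmap U k1 ∘ v) (fmap U k2 ∘ v)) as [t [_ ht]].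
    { now rewrite !comp_assoc, hc. }
    rewrite <- (ht u (conj euv e2)). exact (ht v (conj eq_refl eq_refl)). }
  apply hm. now rewrite comp_assoc, e, comp_idl, comp_idr. }
destruct (hmono _ _ d (split_mono_is_mono d1) hUd) as [d' [_ hd']].
(* Both projections of the kernel pair are left inverses of [d], hence equal to [d']. *)
assert (e12 : k1 = k2).
{ rewrite <- (comp_idr k1), <- (comp_idr k2), <- hd', !comp_assoc.
  now rewrite d1, d2. }
intros w u v euv. destruct (proj2 hk w u v euv) as [t [[h1 h2] _]].
now rewrite <- h1, <- h2, e12.
Qed.

(** * Right adjoints *)

Section Adjoint.

Variables (A X : Category) (F : Functor X A) (U : Functor A X).
Variable adj : Adjunction F U.

Lemma transpose_postcomp (x : X) (a a' : A) (k : Hom a a') (f : Hom (F x) a) :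
  transpose adj (k ∘ f) = fmap U k ∘ transpose adj f.
Proof.
rewrite <- (comp_idr (fmap U k ∘ _)), <- transpose_natural.
now rewrite fmap_id, comp_idr.
Qed.

Lemma untranspose_postcomp (x : X) (a a' : A) (k : Hom a a') (g : Hom x (U a)) :
  untranspose adj (fmap U k ∘ g) = k ∘ untranspose adj g.
Proof.
rewrite <- (transposeK adj (k ∘ _)), transpose_postcomp. now rewrite untransposeK.
Qed.

(** A cone over the image of [D] with apex [x] transposes leg by leg to a cone over [D] with apex
    [F x], whose mediating map transposes back. *)
Lemma adjunction_left_exact : left_exact U.
Proof.
intros J _ D c hc c'.
unshelve epose (k := _ : Cone D).
{ refine {| apex := F (apex c');
            leg := fun j => untranspose adj (leg c' j : Hom _ (U (D j))) |}.
  intros i j a. rewrite <- untranspose_postcomp. f_equal.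
  exact (leg_natural c' a). }
destruct (hc k) as [u [hu huu]].
exists (transpose adj u). split.
- intros j. simpl. rewrite <- transpose_postcomp, <- (untransposeK adj (leg c' j)).
  f_equal. exact (hu j).
- intros v hv. rewrite <- (untransposeK adj v). f_equal. apply huu.
  intros j. simpl. rewrite <- untranspose_postcomp. f_equal. exact (hv j).
Qed.

(** Supplies the initial object in (2) ⇒ (3): maps [F z → a] correspond to maps [z → U a]. *)
Lemma left_adjoint_initial (z : X) : is_initial z -> is_initial (F z).
Proof.
intros hz a. destruct (hz (U a)) as [u _].
exists (untranspose adj u). split; [exact I|].
intros v _. rewrite <- (transposeK adj v). f_equal. now apply is_initial_hom_eq.
Qed.

End Adjoint.

(** * Slice categories *)

Section Slice.

Variables (A : Category) (b : A).

Record slice_ob := { sl_dom : A; sl_map : Hom sl_dom b }.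

Definition slice_hom (x y : slice_ob) : Type :=
  { h : Hom (sl_dom x) (sl_dom y) | sl_map y ∘ h = sl_map x }.

Lemma slice_hom_eq (x y : slice_ob) (f g : slice_hom x y) :
  proj1_sig f = proj1_sig g -> f = g.
Proof.
destruct f as [f hf], g as [g hg]; simpl. intros ->. f_equal.
apply proof_irrelevance.
Qed.

Definition slice : Category.
Proof.
unshelve refine {| Ob := slice_ob; Hom := slice_hom;
  idm := fun x => exist _ (idm (sl_dom x)) (comp_idr _);
  comp := fun x y z g f => exist _ (proj1_sig g ∘ proj1_sig f) _ |}.
- rewrite comp_assoc, (proj2_sig g). exact (proj2_sig f).
- intros. apply slice_hom_eq, comp_idl.
- intros. apply slice_hom_eq, comp_idr.
- intros. apply slice_hom_eq, comp_assoc.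
Defined.

Definition slice_forget : Functor slice A.
Proof.
refine {| fob := fun x : slice => sl_dom x;
          fmap := fun (x y : slice) (f : Hom x y) => proj1_sig f |}; reflexivity.
Defined.

Lemma slice_pointed : is_initial b -> pointed slice.
Proof.
intros hb. exists {| sl_dom := b; sl_map := idm b |}. split.
- intros x. destruct (hb (sl_dom x)) as [u _].
  unshelve eexists; [exists u; now apply is_initial_hom_eq|].
  split; [exact I|]. intros v _. apply slice_hom_eq. now apply is_initial_hom_eq.
- intros x. unshelve eexists; [exists (sl_map x); apply comp_idl|].
  split; [exact I|]. intros [v hv] _. apply slice_hom_eq. simpl in *. now rewrite <- hv, comp_idl.
Qed.

End Slice.

(** * Finite limits in a slice *)

Section AdjoinTerminal.

Variable J : Category.

(** The shape [J] with a new terminal object [None]. A diagram of shape [J] in the slice over [b]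
    amounts to a diagram of this larger shape in [A] that sends [None] to [b]. *)
Definition adjoin_terminal_hom (i j : option J) : Type :=
  match i, j with
  | Some i, Some j => Hom i j
  | _, None => unit
  | None, Some _ => Empty_set
  end.

Definition adjoin_terminal : Category.
Proof.
refine {| Ob := option J; Hom := adjoin_terminal_hom;
          idm := fun i => match i with Some i => idm i | None => tt end;
          comp := fun i j k =>
            match i, j, k return
              adjoin_terminal_hom j k -> adjoin_terminal_hom i j ->
              adjoin_terminal_hom i k
            with
            | Some _, Some _, Some _ => fun g f => g ∘ f
            | _, None, Some _ => fun g _ => match g with end
            | None, Some _, _ => fun _ f => match f with end
            | Some _, _, None => fun _ _ => tt
            | None, None, None => fun _ _ => tt
            end |}.
- intros [i|] [j|] f; try destruct f; simpl; trivial. apply comp_idl.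
- intros [i|] [j|] f; try destruct f; simpl; trivial. apply comp_idr.
- intros [i|] [j|] [k|] [l|] h g f; simpl in *;
    try contradiction; trivial. apply comp_assoc.
Defined.

Lemma adjoin_terminal_finite :
  finite_category J -> finite_category adjoin_terminal.
Proof.
intros [[l hl] hh]. split.
- exists (None :: map Some l). intros [i|]; [right; now apply in_map|now left].
- intros [i|] [j|]; [exact (hh i j)|..];
    first [exists (tt :: nil); intros []; simpl; tauto | exists nil; intros []].
Qed.

Variables (A : Category) (b : A) (D : Functor J (slice b)).

Definition slice_diagram_ob (i : option J) : A :=
  match i with Some i => sl_dom (D i) | None => b end.

Definition slice_diagram : Functor adjoin_terminal A.
Proof.
refine {| fob := slice_diagram_ob : adjoin_terminal -> A;
          fmap := fun i j : adjoin_terminal =>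
            match i, j return adjoin_terminal_hom i j ->
              Hom (slice_diagram_ob i) (slice_diagram_ob j)
            with
            | Some i, Some j => fun f => proj1_sig (fmap D f)
            | Some i, None => fun _ => sl_map (D i)
            | None, None => fun _ => idm b
            | None, Some _ => fun e => match e with end
            end |}.
- intros [i|]; simpl; [now rewrite fmap_id|reflexivity].
- intros [i|] [j|] [k|] g f; simpl in *; try contradiction;
    rewrite ?comp_idl; trivial.
  + now rewrite fmap_comp.
  + symmetry. exact (proj2_sig (fmap D f)).
Defined.

End AdjoinTerminal.

(** The limit is taken in [A] over the extended diagram; its leg at [None] becomes the structure map
    of the limit object. *)
Lemma slice_finitely_complete (A : Category) (b : A) :
  finitely_complete A -> finitely_complete (slice b).
Proof.
intros hA J hJ D.
destruct (hA _ (adjoin_terminal_finite hJ) (slice_diagram D)) as [c hc].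
unshelve eexists.
{ refine {| apex := {| sl_dom := apex c; sl_map := leg c None |} : slice b;
    leg := fun j => exist _ (leg c (Some j))
      (leg_natural c (tt : @Hom (adjoin_terminal J) (Some j) None)) |}.
  intros i j a. apply slice_hom_eq.
  exact (leg_natural c (a : @Hom (adjoin_terminal J) (Some i) (Some j))). }
intros c'.
(* A cone in the slice extends to [None] by the structure map of its apex. *)
unshelve epose (k := _ : Cone (slice_diagram D)).
{ refine {| apex := sl_dom (apex c');
    leg := fun j : adjoin_terminal J =>
      match j return Hom (sl_dom (apex c')) (slice_diagram D j) with
      | Some j => proj1_sig (leg c' j)
      | None => sl_map (apex c')
      end |}.
  intros [i|] [j|] a; simpl in *; try contradiction.
  - exact (f_equal (@proj1_sig _ _) (leg_natural c' a)).
  - exact (proj2_sig (leg c' i)).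
  - apply comp_idl. }
destruct (hc k) as [u [hu huu]].
(* The equation at [None] says that [u] commutes with the structure maps to [b]. *)
exists (exist _ u (hu None)). split.
- intros j. apply slice_hom_eq. exact (hu (Some j)).
- intros [v hv] h. apply slice_hom_eq. apply huu. intros [j|]; [|exact hv].
  exact (f_equal (@proj1_sig _ _) (h j)).
Qed.

(** * Base change to a slice *)

(** Pairing is stored as data because [base_change] must act on morphisms by a function, while
    [is_pullback] only asserts existence. *)
Record product_with (A : Category) (x b : A) := {
  pw_ob : A;
  pw_fst : Hom pw_ob x;
  pw_snd : Hom pw_ob b;
  pw_pair : forall q : A, Hom q x -> Hom q b -> Hom q pw_ob;
  pw_pair_fst : forall (q : A) (f : Hom q x) (g : Hom q b),
    pw_fst ∘ pw_pair f g = f;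
  pw_pair_snd : forall (q : A) (f : Hom q x) (g : Hom q b),
    pw_snd ∘ pw_pair f g = g;
  pw_ext : forall (q : A) (u v : Hom q pw_ob),
    pw_fst ∘ u = pw_fst ∘ v -> pw_snd ∘ u = pw_snd ∘ v -> u = v
}.

Lemma finitely_complete_product_with (A : Category) (x b : A) :
  finitely_complete A -> inhabited (product_with x b).
Proof.
intros hA. destruct (finitely_complete_terminal hA) as [t ht].
destruct (ht x) as [tx _], (ht b) as [tb _].
destruct (finitely_complete_pullback hA tx tb) as (p & p1 & p2 & _ & hp).
assert (hp' : forall q (f : Hom q x) (g : Hom q b),
    exists! u, p1 ∘ u = f /\ p2 ∘ u = g)
  by (intros; now apply hp, is_terminal_hom_eq).
(* Choice turns the existence of mediating maps into a pairing function. *)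
pose (pr := fun q f g => constructive_indefinite_description _ (hp' q f g)).
constructor.
refine {| pw_ob := p; pw_fst := p1; pw_snd := p2;
          pw_pair := fun q f g => proj1_sig (pr q f g) |}.
- intros q f g. exact (proj1 (proj1 (proj2_sig (pr q f g)))).
- intros q f g. exact (proj2 (proj1 (proj2_sig (pr q f g)))).
- intros q u v h1 h2. destruct (hp' q (p1 ∘ v) (p2 ∘ v)) as [w [_ hw]].
  rewrite <- (hw u (conj h1 h2)). exact (hw v (conj eq_refl eq_refl)).
Qed.

(** Exhibits the projection to [x] as a pullback of a map [b → t], the form in which universality of
    an extremal epimorphism applies to it. *)
Lemma product_with_is_pullback (A : Category) (x b t : A) (P : product_with x b)
    (f : Hom b t) (g : Hom x t) :
  is_terminal t -> is_pullback f g (pw_snd P) (pw_fst P).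
Proof.
intros ht. split; [now apply is_terminal_hom_eq|].
intros q q1 q2 _. exists (pw_pair P q2 q1). split.
- now rewrite pw_pair_fst, pw_pair_snd.
- intros u [h1 h2]. apply (pw_ext (p := P)).
  + now rewrite pw_pair_fst.
  + now rewrite pw_pair_snd.
Qed.

Section BaseChange.

Variables (A : Category) (b : A) (P : forall x : A, product_with x b).

(** This is [f × b], the product of [f] with the identity of [b]. *)
Definition base_change_hom (x y : A) (f : Hom x y) :
    Hom (pw_ob (P x)) (pw_ob (P y)) :=
  pw_pair (P y) (f ∘ pw_fst (P x)) (pw_snd (P x)).

Definition base_change : Functor A (slice b).
Proof.
unshelve refine {|
  fob := fun x => {| sl_dom := pw_ob (P x); sl_map := pw_snd (P x) |} : slice b;
  fmap := fun x y f => exist _ (base_change_hom f) _ |}.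
- apply pw_pair_snd.
- intros x. apply slice_hom_eq, pw_ext; simpl; unfold base_change_hom.
  + now rewrite pw_pair_fst, comp_idl, comp_idr.
  + now rewrite pw_pair_snd, comp_idr.
- intros x y z g f. apply slice_hom_eq, pw_ext; simpl; unfold base_change_hom.
  + now rewrite comp_assoc, !pw_pair_fst, <- !comp_assoc, pw_pair_fst.
  + now rewrite comp_assoc, !pw_pair_snd.
Defined.

(** A morphism over [b] into [a × b] has the structure map as its second component, so it amounts to
    its first component, which is arbitrary. *)
Lemma base_change_adjunction : Adjunction (slice_forget b) base_change.
Proof.
unshelve refine {|
  transpose := fun x a (f : Hom (slice_forget b x) a) =>
    exist _ (pw_pair (P a) f (sl_map x)) _ : Hom x (base_change a);
  untranspose := fun x a (g : Hom x (base_change a)) =>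
    pw_fst (P a) ∘ proj1_sig g |}.
- apply pw_pair_snd.
- intros x a f. apply pw_pair_fst.
- intros x a [g hg]. apply slice_hom_eq, pw_ext; simpl in *.
  + apply pw_pair_fst.
  + now rewrite pw_pair_snd.
- intros x x' a a' h k f.
  apply slice_hom_eq, pw_ext; simpl; unfold base_change_hom.
  + rewrite !comp_assoc, !pw_pair_fst.
    now rewrite <- (comp_assoc k (pw_fst _)), pw_pair_fst.
  + rewrite !comp_assoc, !pw_pair_snd. symmetry. exact (proj2_sig h).
Qed.

Lemma base_change_conservative (t : A) (f : Hom b t) :
  finitely_complete A -> is_terminal t -> is_universal_extremal_epi f ->
  conservative base_change.
Proof.
intros hA ht [_ hf].
apply (left_exact_conservative hA (adjunction_left_exact base_change_adjunction)).
intros x y m hm [h [_ hh]]. destruct (ht y) as [ty _].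
(* The projection [y × b → y] is a pullback of [f], hence extremal, and it factors through [m]: it
   equals [m] after the first projection after [h], since [h] inverts [m × b]. *)
apply (hf _ _ ty _ _ (product_with_is_pullback (P y) f ty ht) x
  (pw_fst (P x) ∘ proj1_sig h) m hm).
assert (e : base_change_hom m ∘ proj1_sig h = idm (pw_ob (P y)))
  by exact (f_equal (@proj1_sig _ _) hh).
rewrite <- (comp_idr (pw_fst (P y))), <- e. unfold base_change_hom.
now rewrite !comp_assoc, pw_pair_fst.
Qed.

End BaseChange.

(** * The implications between the three conditions *)

Lemma propointed_conservative_right_adjoint (A : Category) :
  propointed A ->
  exists (X : Category) (U : Functor A X),
    pointed X /\ finitely_complete X /\ conservative U /\ right_adjoint U.
Proof.
intros [hA (z & t & f & hz & ht & hf)].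
(* Products with [z] are chosen for all objects at once; the predicate [True] serves to extract a
   witness from [inhabited]. *)
assert (P : forall x : A, product_with x z).
{ intros x.
  apply (constructive_indefinite_description (fun _ : product_with x z => True)).
  destruct (finitely_complete_product_with x z hA) as [p]. now exists p. }
exists (slice z), (base_change P). repeat split.
- now apply slice_pointed.
- now apply slice_finitely_complete.
- exact (base_change_conservative hA ht hf).
- exists (slice_forget z). constructor. apply base_change_adjunction.
Qed.

(** The section of [p2] is induced by [s ∘ g] and the identity of [z]. *)
Lemma pullback_split_epi (A : Category) (x y z p : A) (f : Hom x y) (g : Hom z y)
    (p1 : Hom p x) (p2 : Hom p z) (s : Hom y x) :
  is_pullback f g p1 p2 -> f ∘ s = idm y -> exists r, p2 ∘ r = idm z.
Proof.
intros [_ h] hs. destruct (h z (s ∘ g) (idm z)) as [r [[_ hr] _]].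
- now rewrite comp_assoc, hs, comp_idl, comp_idr.
- now exists r.
Qed.

(** If [f = m ∘ g] with [m] monic, then [fmap U g ∘ s] is a section of the monomorphism [fmap U m].
    This serves both for [0 → 1] and for its pullbacks. *)
Lemma conservative_reflects_extremal_epi (A X : Category) (U : Functor A X)
    (x y : A) (f : Hom x y) (s : Hom (U y) (U x)) :
  left_exact U -> conservative U -> fmap U f ∘ s = idm (U y) ->
  is_extremal_epi f.
Proof.
intros hl hc hs w g m hm e. apply hc.
apply (mono_split_epi_is_iso (s := fmap U g ∘ s)).
- now apply left_exact_mono.
- now rewrite comp_assoc, <- fmap_comp, <- e.
Qed.

Lemma conservative_left_exact_propointed (A X : Category) (U : Functor A X) :
  finitely_complete A -> has_initial A -> pointed X ->
  conservative U -> left_exact U -> propointed A.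
Proof.
intros hA [z hz] [o [hoi hot]] hc hl. split; [exact hA|].
destruct (finitely_complete_terminal hA) as [t ht]. destruct (hz t) as [f _].
assert (hUt := left_exact_terminal hl ht).
assert (hs : exists s, fmap U f ∘ s = idm (U t)).
(* The section runs from [U t] to [U z] through the zero object [o]; the required identity holds
   because [U t] is terminal. *)
{ destruct (hot (U t)) as [a _], (hoi (U z)) as [i _].
  exists (i ∘ a). now apply is_terminal_hom_eq. }
destruct hs as [s hs].
exists z, t, f. repeat split; [exact hz|exact ht|..].
- exact (conservative_reflects_extremal_epi hl hc hs).
- intros w p g p1 p2 hp.
  destruct (pullback_split_epi (left_exact_pullback hl hp) hs) as [r hr].
  exact (conservative_reflects_extremal_epi hl hc hr).
Qed.

Theorem theorem2p2 (A : Category) (hA : finitely_complete A) :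
  (propointed A <->
   exists (X : Category) (U : Functor A X),
     pointed X /\ finitely_complete X /\ conservative U /\ right_adjoint U) /\
  (propointed A <->
   (has_initial A /\
    exists (X : Category) (U : Functor A X),
      pointed X /\ finitely_complete X /\ conservative U /\ left_exact U)).
Proof.
assert (h12 := @propointed_conservative_right_adjoint A).
assert (h23 : (exists (X : Category) (U : Functor A X),
     pointed X /\ finitely_complete X /\ conservative U /\ right_adjoint U) ->
   has_initial A /\
    exists (X : Category) (U : Functor A X),
      pointed X /\ finitely_complete X /\ conservative U /\ left_exact U).
{ intros (X & U & hX & hXc & hc & F & [adj]). split.
  - destruct hX as [z [hz _]]. exists (F z). exact (left_adjoint_initial adj hz).
  - exists X, U. repeat split; trivial. exact (adjunction_left_exact adj). }
assert (h31 : (has_initial A /\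
    exists (X : Category) (U : Functor A X),
      pointed X /\ finitely_complete X /\ conservative U /\ left_exact U) ->
   propointed A).
{ intros [hi (X & U & hX & _ & hc & hl)].
  exact (conservative_left_exact_propointed hA hi hX hc hl). }
tauto.
Qed.
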